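(* For every integer $n$ there is a graph $G$ with layered treewidth $1$ and row treewidth at least $n$, such that $G$ is a weak $1$-shallow minor of $J\,\square\,P$ for some apex-forest $J$ and some path $P$.
   Context: Graphs are finite, simple and undirected. A graph $J$ is an apex-forest if $J-A$ is a forest for some $A\subseteq V(J)$ with $|A|\le1$. The cartesian product $G_1\,\square\,G_2$ has vertex set $V(G_1)\times V(G_2)$, where distinct vertices $(a,v)$ and $(b,u)$ are adjacent if $ab\in E(G_1)$ and $v=u$; or $a=b$ and $uv\in E(G_2)$. The strong product $G_1 \boxtimes G_2$ has the same vertex set, where distinct vertices $(a,v)$ and $(b,u)$ are adjacent if $ab\in E(G_1)$ and $v=u$; or $a=b$ and $uv\in E(G_2)$; or $ab\in E(G_1)$ and $uv\in E(G_2)$. The row treewidth of a graph $G$ is the minimum treewidth of a graph $H$ such that $G$ is isomorphic to a subgraph of $H\boxtimes P'$ for some path $P'$. A layering of a graph $G$ is a partition $(V_0,V_1,\dots,V_q)$ of $V(G)$ such that for every edge $vw$, if $v\in V_i$ and $w\in V_j$ then $|i-j|\le1$. The layered width of a tree decomposition $(T,B)$ of $G$ is the minimum integer $\ell$ such that, for some layering $(V_0,\dots,V_q)$ of $G$, each bag $B(x)$ contains at most $\ell$ vertices of each layer $V_i$. The layered treewidth of $G$ is the minimum layered width of a tree decomposition of $G$. A model of a graph $G$ in a graph $H$ is a function $\mu:V(G)\to2^{V(H)}$ such that: for each $v\in V(G)$, $\mu(v)$ is non-empty and $H[\mu(v)]$ is connected; $\mu(v)\cap\mu(w)=\emptyset$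 for distinct $v,w\in V(G)$; and for every edge $vw\in E(G)$ there is an edge $ab\in E(H)$ with $a\in\mu(v)$ and $b\in\mu(w)$. The weak radius of a set $A\subseteq V(H)$ in $H$ is the minimum non-negative integer $r$ such that for some $v\in V(H)$ and every $a\in A$ we have $\mathrm{dist}_H(v,a)\le r$. A model $\mu$ of $G$ in $H$ is weak $r$-shallow if for each $v\in V(G)$, the weak radius of $\mu(v)$ in $H$ is at most $r$. $G$ is a weak $r$-shallow minor of $H$ if there exists a weak $r$-shallow model of $G$ in $H$. *)

(* Defs.v *)
From mathcomp Require Import all_boot all_order all_algebra.

Set Implicit Arguments.
Unset Strict Implicit.
Unset Printing Implicit Defensive.

Import Order.TTheory GRing.Theory Num.Theory.

(* [is_min P m]: m is the minimum of {k | P k}. Numerical graph invariants are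
   functional relations built from it, so no junk value is involved when the
   minimum does not exist (e.g. the distance between two components). *)
Definition is_min d (T : porderType d) (P : T -> Prop) (m : T) : Prop :=
  P m /\ forall k, P k -> (m <= k)%O.

Record graph := Graph {
  vertex :> finType;
  adj : rel vertex;
  adj_sym : symmetric adj;
  adj_irr : irreflexive adj }.

Arguments adj {g} : rename.

Section Constructions.

Variables (G H : graph).

Definition induced_adj (S : {set G}) : rel {x : G | x \in S} :=
  fun x y => adj (val x) (val y).

Fact induced_adj_sym S : symmetric (@induced_adj S).
Proof. by move=> x y; apply: adj_sym. Qed.

Fact induced_adj_irr S : irreflexive (@induced_adj S).
Proof. by move=> x; apply: adj_irr. Qed.

Definition induced (S : {set G}) : graph :=
  Graph (@induced_adj_sym S) (@induced_adj_irr S).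

Definition cartesian_adj : rel (G * H) := fun x y =>
  (adj x.1 y.1 && (x.2 == y.2)) || ((x.1 == y.1) && adj x.2 y.2).

Fact cartesian_adj_sym : symmetric cartesian_adj.
Proof.
by move=> x y; rewrite /cartesian_adj !(adj_sym x.1) !(adj_sym x.2) !(eq_sym x.1)
  !(eq_sym x.2).
Qed.

Fact cartesian_adj_irr : irreflexive cartesian_adj.
Proof. by move=> x; rewrite /cartesian_adj !adj_irr andbF. Qed.

Definition cartesian : graph := Graph cartesian_adj_sym cartesian_adj_irr.

Definition strong_adj : rel (G * H) := fun x y =>
  [|| adj x.1 y.1 && (x.2 == y.2),
      (x.1 == y.1) && adj x.2 y.2
    | adj x.1 y.1 && adj x.2 y.2].

Fact strong_adj_sym : symmetric strong_adj.
Proof.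
by move=> x y; rewrite /strong_adj !(adj_sym x.1) !(adj_sym x.2) !(eq_sym x.1)
  !(eq_sym x.2).
Qed.

Fact strong_adj_irr : irreflexive strong_adj.
Proof. by move=> x; rewrite /strong_adj !adj_irr andbF. Qed.

Definition strong : graph := Graph strong_adj_sym strong_adj_irr.

End Constructions.

Definition path_adj m : rel 'I_m.+1 := fun i j =>
  (i.+1 == j :> nat) || (j.+1 == i :> nat).

Fact path_adj_sym m : symmetric (@path_adj m).
Proof. by move=> i j; rewrite /path_adj orbC. Qed.

Fact path_adj_irr m : irreflexive (@path_adj m).
Proof. by move=> i; rewrite /path_adj orbb gtn_eqF. Qed.

(* The path with m edges, hence m + 1 vertices. *)
Definition path_graph m : graph := Graph (@path_adj_sym m) (@path_adj_irr m).

(* Holds for the empty graph; non-emptiness is required separately. *)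
Definition connected (G : graph) : Prop := forall x y : G, connect adj x y.

(* [ucycle adj c] also holds when c is empty or lists the two ends of an edge;
   the graph-theoretic cycles are those with at least three vertices. *)
Definition forest (G : graph) : Prop :=
  forall c : seq G, ucycle adj c -> size c <= 2.

Definition tree (G : graph) : Prop := [/\ 0 < #|G|, connected G & forest G].

Definition apex_forest (J : graph) : Prop :=
  exists A : {set J}, #|A| <= 1 /\ forest (induced (~: A)).

Definition isomorphic_to_subgraph (G H : graph) : Prop :=
  exists f : G -> H, injective f /\ {homo f : x y / adj x y}.

Definition tree_decomposition (G T : graph) (B : T -> {set G}) : Prop :=
  [/\ tree T,
      forall v : G, exists x : T, v \in B x,
      forall v w : G, adj v w -> exists x : T, (v \in B x) && (w \in B x)
    & forall v : G, connected (induced [set x : T | v \in B x])].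

(* Integer-valued, so that the decomposition with only empty bags has width -1
   rather than a truncated 0. *)
Definition width (G T : graph) (B : T -> {set G}) : int :=
  ((\max_(x : T) #|B x|)%N%:Z - 1)%R.

Definition is_treewidth (G : graph) : int -> Prop :=
  is_min (fun w => exists (T : graph) (B : T -> {set G}),
    tree_decomposition B /\ w = width B).

Definition is_row_treewidth (G : graph) : int -> Prop :=
  is_min (fun w => exists (H : graph) (m : nat),
    is_treewidth H w /\ isomorphic_to_subgraph G (strong H (path_graph m))).

(* The layering (V_0, ..., V_q) is given by the map sending each vertex to the
   index of its part; q is any bound on the values of that map. *)
Definition layering (G : graph) (lam : G -> nat) : Prop :=
  forall v w : G, adj v w -> `|lam v - lam w|%N <= 1.

Definition layer (G : graph) (lam : G -> nat) (i : nat) : {set G} :=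
  [set v | lam v == i].

Definition is_layered_width (G T : graph) (B : T -> {set G}) : nat -> Prop :=
  is_min (fun l => exists lam : G -> nat, layering lam /\
    forall (x : T) (i : nat), #|B x :&: layer lam i| <= l).

Definition is_layered_treewidth (G : graph) : nat -> Prop :=
  is_min (fun l => exists (T : graph) (B : T -> {set G}),
    tree_decomposition B /\ is_layered_width B l).

Definition model (G H : graph) (mu : G -> {set H}) : Prop :=
  [/\ forall v : G, mu v != set0 /\ connected (induced (mu v)),
      forall v w : G, v != w -> [disjoint mu v & mu w]
    & forall v w : G, adj v w ->
        exists a b : H, [/\ a \in mu v, b \in mu w & adj a b]].

Definition is_dist (H : graph) (v a : H) : nat -> Prop :=
  is_min (fun d => exists p : seq H,
    [/\ path adj v p, last v p = a & size p = d]).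

Definition is_weak_radius (H : graph) (A : {set H}) : nat -> Prop :=
  is_min (fun r => exists v : H, forall a, a \in A ->
    exists d, is_dist v a d /\ d <= r).

Definition weak_shallow (r : nat) (G H : graph) (mu : G -> {set H}) : Prop :=
  forall v : G, exists k, is_weak_radius (mu v) k /\ k <= r.

Definition weak_shallow_minor (r : nat) (G H : graph) : Prop :=
  exists mu : G -> {set H}, model mu /\ weak_shallow r mu.

(* Main.v *)
Require Import Defs.
From mathcomp Require Import all_boot all_order all_algebra zify.
From Stdlib Require Import Classical.

(** Layered treewidth one already implies the minor condition. Take a tree
    decomposition [(T, B)] and a layering such that no bag has two vertices in
    the same layer. Replace each vertex by its subtree of [T], placed in the
    row of its layer, inside the product of a path with the cone over [T]
    (a tree plus a dominating apex). This is a model, and the apex makes it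
    weak 1-shallow ([weak_shallow_minor_of_ltw1]). It remains to find graphs
    of layered treewidth one and large row treewidth.

    The graph used is the prefix graph. Its vertices are the words of length at
    most [L] over a large alphabet; the layer of a word is its length modulo
    [l], and two words are adjacent when one is a prefix of the other, their
    lengths differ by less than [l], and their layers are consecutive. The tree
    of words, with the prefixes of [w] of length greater than [size w - l] as
    the bag at [w], shows that the layered treewidth is one
    ([prefix_graph_ltw1]).

    Suppose that it is contained in the strong product of [H] and a path, and
    call the set of vertices with a given [H]-coordinate a part. Siblings have
    a common neighbour, so a part contains at most three of them. As the
    alphabet is large, one can descend from the empty word to a word of length
    [L] while entering a new part at each step
    ([branch_with_distinct_parts]). The prefixes of that word induce a subgraph
    which therefore also occurs in [H]. For [l = 2k] and [L = 2k * k] it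
    contains a sheared grid with [k] columns and [2k] rows. By the Helly
    property of subtrees, a tree decomposition of [H] has a bag that meets all
    the crosses of this grid, and such a bag has at least [k] vertices
    ([grid_large_bag]). Hence [H] has treewidth at least [k - 1]. *)

Set Implicit Arguments.
Unset Strict Implicit.
Unset Printing Implicit Defensive.

(** * Existence of minima *)

Lemma is_min_nat_exists (P : nat -> Prop) k :
  P k -> exists m, is_min P m /\ m <= k.
Proof.
elim/ltn_ind: k => k IHk Pk.
case: (classic (exists2 j, j < k & P j)) => [[j jk Pj]|nP].
  by have [m [minm mj]] := IHk j jk Pj; exists m; split=> //; lia.
exists k; split=> //; split=> // j Pj; rewrite leEnat leqNgt.
by apply/negP => jk; apply: nP; exists j.
Qed.

Lemma is_min_int_exists (P : int -> Prop) (b w : int) :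
  (forall v, P v -> (b <= v)%R) -> P w -> exists m, is_min P m.
Proof.
move=> Pb Pw; have bw := Pb w Pw.
have [|m [[Pm minm] _]] :=
    @is_min_nat_exists (fun j : nat => P (b + j%:Z)%R) `|w - b|%N.
  by have -> : (b + `|w - b|%N%:Z)%R = w by lia.
exists (b + m%:Z)%R; split=> // v Pv.
have := minm `|v - b|%N; have := Pb v Pv; rewrite leEnat => bv.
have -> : (b + `|v - b|%N%:Z)%R = v by lia.
by move/(_ Pv); lia.
Qed.

(** * Connected vertex sets *)

Lemma connect_homo (T T' : finType) (e : rel T) (e' : rel T') (f : T -> T') :
  {homo f : x y / e x y >-> e' x y} ->
  {homo f : x y / connect e x y >-> connect e' x y}.
Proof.
move=> fe x y /connectP[p ep ->]; apply/connectP; exists (map f p).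
  by rewrite (homo_path fe).
by rewrite last_map.
Qed.

Definition within (G : graph) (S : {set G}) (x y : G) : bool :=
  [&& x \in S, y \in S & adj x y].

Arguments within {G} S x y /.

Lemma within_sym (G : graph) (S : {set G}) : symmetric (within S).
Proof. by move=> x y; rewrite /= adj_sym andbCA. Qed.

Lemma connect_withinC (G : graph) (S : {set G}) : connect_sym (within S).
Proof. exact/sym_connect_sym/within_sym. Qed.

Lemma within_sub (G : graph) (S S' : {set G}) :
  S \subset S' -> subrel (connect (within S)) (connect (within S')).
Proof.
move=> /subsetP SS'; apply: connect_homo => x y /and3P[xS yS xy].
by rewrite /= !SS'.
Qed.

Lemma connected_inducedP (G : graph) (S : {set G}) :
  connected (induced S) <-> {in S &, forall x y, connect (within S) x y}.
Proof.
split=> [cS x y xS yS | cS x y].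
  have := cS (exist _ x xS) (exist _ y yS).
  apply: (@connect_homo _ _ _ _ val) => u v uv.
  by rewrite /= (valP u) (valP v).
have := cS _ _ (valP x) (valP y).
rewrite -[x in connect adj x](valKd x) -[y in connect adj _ y](valKd x).
apply: (@connect_homo _ _ _ _ (insubd x)) => u v /and3P[uS vS uv].
by rewrite /= /induced_adj !insubdK.
Qed.

Lemma connected_of_root (G : graph) (S : {set G}) (r : G) :
  {in S, forall x, connect (within S) x r} -> connected (induced S).
Proof.
move=> Sr; apply/connected_inducedP => x y xS yS.
by apply: connect_trans (Sr x xS) _; rewrite connect_withinC Sr.
Qed.

(** A walk that always steps to a neighbour of smaller rank can only stop at
    [r]; this is how connectivity of the sets built from rooted trees is
    checked. *)
Lemma connected_of_descent (G : graph) (S : {set G}) (r : G) (rk : G -> nat) :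
  (forall x, x \in S -> x != r ->
     exists y, [/\ y \in S, adj x y & rk y < rk x]) ->
  connected (induced S).
Proof.
move=> desc; apply: (@connected_of_root _ _ r) => x.
have [n] := ubnP (rk x); elim: n x => // n IHn x xn xS.
have [-> // | xr] := eqVneq x r.
have [y [yS xy yx]] := desc x xS xr.
apply: (connect_trans (connect1 _)); last by apply: IHn yS; lia.
by rewrite /= xS yS.
Qed.

Lemma connected_imset (G H : graph) (S : {set G}) (f : G -> H) :
  connected (induced S) ->
  {in S &, forall x y, adj x y -> adj (f x) (f y)} ->
  connected (induced (f @: S)).
Proof.
move=> /connected_inducedP cS fS; apply/connected_inducedP.
move=> _ _ /imsetP[x xS ->] /imsetP[y yS ->].
have := cS x y xS yS.
apply: (@connect_homo _ _ _ _ f) => u v /and3P[uS vS uv].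
by rewrite /= !imset_f //= fS.
Qed.

Lemma connectedT (G : graph) : connected G <-> connected (induced [set: G]).
Proof.
split=> [cG | /connected_inducedP cG x y].
  apply/connected_inducedP => x y _ _; have := cG x y.
  by apply: (@connect_homo _ _ _ _ id) => u v uv; rewrite /= !inE.
have := cG x y (in_setT _) (in_setT _).
by apply: (@connect_homo _ _ _ _ id) => u v /and3P[].
Qed.

(** * Forests *)

Lemma forest_inj_homo (G H : graph) (f : G -> H) :
  injective f -> {homo f : x y / adj x y} -> forest H -> forest G.
Proof.
move=> f_inj f_adj fH c /andP[cc uc]; rewrite -(size_map f); apply: fH.
by rewrite /ucycle /= (homo_cycle f_adj) // map_inj_uniq.
Qed.

(** In a cycle, both neighbours of a vertex of maximum rank would have to be
    its parent, so they coincide and the cycle is an edge. *)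
Lemma forest_of_parent (G : graph) (rk : G -> nat) (par : G -> G) :
  (forall x y : G, adj x y ->
     (rk x < rk y /\ par y = x) \/ (rk y < rk x /\ par x = y)) ->
  forest G.
Proof.
move=> adjP c /andP[cc uc]; case: c => // x0 c0 in cc uc *.
have [x xc xmax] := arg_maxnP rk (mem_head x0 c0).
have parx y : y \in x0 :: c0 -> adj x y -> y = par x.
  by move=> yc /adjP[[xy _] | [_ <-]] //; have := xmax y yc; lia.
have [i s es] := rot_to xc.
have memE y : y \in x :: s -> y \in x0 :: c0 by rewrite -es mem_rot.
have sz : size (x0 :: c0) = size (x :: s) by rewrite -es size_rot.
move: cc uc; rewrite -(rot_cycle i) -(rot_uniq i) es sz /=.
case: s {es sz} => [|y s] // in memE *; case/lastP: s memE => // s z memE.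
rewrite /= rcons_path => /and3P[xy _]; rewrite last_rcons adj_sym => xz.
have -> : y = par x by apply: parx xy; apply: memE; rewrite !inE eqxx orbT.
have -> : z = par x.
  by apply: parx xz; apply: memE; rewrite !inE mem_rcons mem_head !orbT.
by rewrite mem_rcons mem_head andbF.
Qed.

(** A self-map of a finite set has a periodic point. Its orbit is a closed
    walk without repetition, hence a cycle, and a forest only allows the
    cycles that run along an edge and back. *)
Lemma exists_two_cycle (G : graph) (f : G -> G) :
  forest G -> 0 < #|G| -> (forall x, adj x (f x)) -> exists x, f (f x) = x.
Proof.
move=> fG /card_gt0P[x0 _] fadj.
(* An orbit of minimum length has no tail leading into it. *)
have [x _ xmin] := @arg_minnP _ x0 xpredT (order f) isT; exists x.
have [cx _ | _ ox] := orderPcycle f x; last by have := xmin (f x) isT; lia.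
have: size (orbit f x) <= 2.
  apply: fG; rewrite /ucycle orbit_uniq andbT.
  by apply: sub_cycle cx => u v /eqP <-.
have := iter_order_cycle cx (in_orbit f x) (in_orbit f x).
rewrite size_orbit; have := order_gt0 f x.
case: (order f x) => [|[|[|k]]] //= _ fx _.
by have := fadj x; rewrite fx adj_irr.
Qed.

(** Deleting the edge [xy] of a forest leaves no walk from [x] to [y]: such a
    walk would contain a path that closes up, along [xy], to a cycle. A walk
    from [y] to [z] that avoids [x], followed by one from [z] to [x] that
    avoids [y], would be of this kind. *)
Lemma edge_sides_disjoint (G : graph) (x y z : G) :
  forest G -> adj x y ->
  connect (within (~: [set x])) y z -> ~ connect (within (~: [set y])) x z.
Proof.
move=> fG xy yz xz.
pose e := [rel u v | adj u v && ([set u; v] != [set x; y])].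
have sub a : a \in [set x; y] -> {homo id : u v / within (~: [set a]) u v >-> e u v}.
  move=> axy u v /and3P[]; rewrite !inE => ua va uv; rewrite /= uv.
  by apply: contraTneq axy => <-; rewrite !inE negb_or ![a == _]eq_sym ua va.
have e_sym : symmetric e by move=> u v; rewrite /= adj_sym setUC.
have xe : connect e y x.
  apply: connect_trans (_ : connect e z x).
    by apply: (@connect_homo _ _ _ _ id (sub x _)) yz; rewrite !inE eqxx.
  rewrite (sym_connect_sym e_sym).
  by apply: (@connect_homo _ _ _ _ id (sub y _)) xz; rewrite !inE eqxx orbT.
case/connectP: xe => p ep; case/shortenP: ep => {}p ep up _ xE.
have: ucycle adj (y :: p).
  rewrite /ucycle up andbT /= rcons_path -xE xy andbT.
  by apply: sub_path ep => u v /andP[].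
move/fG; case: p ep up xE => [|u [|v p]] //=.
  by move=> _ _ yx; rewrite yx adj_irr in xy.
by rewrite andbT => /andP[_ ne] _ xu; rewrite -xu setUC eqxx in ne.
Qed.

(** A connected set that misses [x] lies in a single branch of the tree at
    [x]; the witness is the neighbour of [x] in that branch. *)
Lemma neighbour_towards (T : graph) (x : T) (S : {set T}) :
  connected T -> connected (induced S) -> S != set0 -> x \notin S ->
  exists y, adj x y /\ {in S, forall z, connect (within (~: [set x])) y z}.
Proof.
move=> cT /connected_inducedP cS /set0Pn[s sS] xS.
case/connectP: (cT x s) => p xp; case/shortenP: xp => {}p xp up _ sE.
case: p xp up sE => [|y p] /=; first by move=> _ _ sx; rewrite -sx sS in xS.
move=> /andP[xy yp] /andP[xNp _] sE; exists y; split=> // z zS.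
apply: (@connect_trans _ _ s).
  apply/connectP; exists p => //.
  elim: p y yp xNp {xy sE} => //= v p IHp u /andP[uv vp].
  rewrite !inE !negb_or => /and3P[xu xv xp].
  by rewrite ![_ == x]eq_sym xu xv uv IHp // inE negb_or xv.
apply: within_sub (cS s z sS zS).
by apply/subsetP => u uS; rewrite !inE; apply: contraNneq xS => <-.
Qed.

(** * The Helly property and brambles *)

(** The Helly property of subtrees. If every node [x] missed some subtree
    [S (U x)], let [f] move each node one step towards the subtree that it
    misses. Then [f] has a 2-cycle, that is, an edge [xy] such that the subtree
    missed by [x] lies on the side of [y] and conversely; these two subtrees
    would be disjoint. *)
Lemma helly_subtrees (T : graph) (I : finType) (S : I -> {set T}) :
  tree T -> (forall i, connected (induced (S i))) ->
  (forall i j, S i :&: S j != set0) -> exists x, forall i, x \in S i.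
Proof.
move=> [T0 cT fT] cS meet; apply: NNPP => none.
have miss x : exists i, x \notin S i.
  apply: NNPP => all; apply: none; exists x => i.
  by apply: contraT => xi; case: all; exists i.
have [U missU] := fin_all_exists miss.
have S0 i : S i != set0 by have := meet i i; rewrite setIid.
have [f fP] := fin_all_exists
  (fun x => neighbour_towards cT (cS (U x)) (S0 (U x)) (missU x)).
have [x ffx] := exists_two_cycle fT T0 (fun x => proj1 (fP x)).
have /set0Pn[z /setIP[zx zy]] := meet (U x) (U (f x)).
have := (fP (f x)).2 z zy; rewrite ffx.
exact: edge_sides_disjoint fT (fP x).1 ((fP x).2 z zx).
Qed.

Lemma connected_trace (H T : graph) (B : T -> {set H}) (U : {set H}) :
  tree_decomposition B -> connected (induced U) ->
  connected (induced [set x | B x :&: U != set0]).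
Proof.
move=> [_ _ edge conn] /connected_inducedP cU; apply/connected_inducedP.
set S := [set x | _]; move=> x y; rewrite !inE.
move=> /set0Pn[a /setIP[ax aU]] /set0Pn[b /setIP[bY bU]].
have bag v u w : v \in U -> v \in B u -> v \in B w -> connect (within S) u w.
  move=> vU vu vw; have /connected_inducedP cv := conn v.
  apply: within_sub (cv u w _ _); rewrite ?inE //.
  by apply/subsetP => t; rewrite !inE => vt; apply/set0Pn; exists v; rewrite inE vt.
case/connectP: (cU a b aU bU) => p.
elim: p a x ax aU => [|c p IHp] a x ax aU /=.
  by move=> _ ba; apply: (bag a) => //; rewrite -ba.
move=> /andP[/and3P[_ cU' ac] cp] bE.
have [t /andP[a_t ct]] := edge a c ac.
by apply: connect_trans (bag a x t aU ax a_t) _; apply: (IHp c).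
Qed.

(** The easy half of the duality between brambles and treewidth, for families
    whose members intersect (rather than merely touch): the traces of the
    sets on the decomposition tree are pairwise intersecting subtrees. *)
Lemma bag_meets_all (H T : graph) (B : T -> {set H}) (I : finType)
    (U : I -> {set H}) :
  tree_decomposition B -> (forall i, connected (induced (U i))) ->
  (forall i j, U i :&: U j != set0) -> exists x, forall i, B x :&: U i != set0.
Proof.
move=> tB cU meet; have [tT cover _ _] := tB.
have [||x xP] := @helly_subtrees T I (fun i => [set x | B x :&: U i != set0]) tT.
- by move=> i; apply: connected_trace.
- move=> i j; have /set0Pn[v /setIP[vi vj]] := meet i j.
  have [x vx] := cover v; apply/set0Pn; exists x; rewrite !inE.
  by apply/andP; split; apply/set0Pn; exists v; rewrite inE vx.
by exists x => i; have := xP i; rewrite inE.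
Qed.

(** * Layered treewidth one and weak shallow minors *)

Definition cone_adj (T : graph) (x y : option T) : bool :=
  match x, y with
  | Some a, Some b => adj a b
  | None, None => false
  | _, _ => true
  end.

Fact cone_adj_sym T : symmetric (@cone_adj T).
Proof. by case=> [x|] [y|] //=; apply: adj_sym. Qed.

Fact cone_adj_irr T : irreflexive (@cone_adj T).
Proof. by case=> [x|] //=; apply: adj_irr. Qed.

Definition cone (T : graph) : graph := Graph (@cone_adj_sym T) (@cone_adj_irr T).

Lemma apex_forest_cone (T : graph) : forest T -> apex_forest (cone T).
Proof.
move=> fT; exists [set None]; rewrite cards1; split=> // -[|z c] //.
have zS : val z \in ~: [set (None : cone T)] by exact: valP.
have [r _]: exists r : T, val z = Some r.
  by move: zS; case: (val z) => [r|]; [exists r | rewrite !inE].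
pose f (x : induced (~: [set (None : cone T)])) : T := odflt r (val x).
have valE x : val x = Some (f x).
  by rewrite /f; have := valP x; case: (val x) => //; rewrite !inE.
apply: (@forest_inj_homo _ T f) => // [x y xy | x y].
  by apply: val_inj; rewrite !valE xy.
by rewrite /= /induced_adj !valE.
Qed.

(** Each vertex [v] is modelled by the copy, in row [lam v], of the subtree
    formed by the nodes whose bags contain [v]. Two vertices in the same layer
    never share a bag, which makes these sets disjoint; adjacent vertices share
    a bag and lie in consecutive layers, which gives the edge of the product.
    The copy of the apex in row [lam v] dominates the whole row, so each set
    has weak radius at most one. *)
Lemma weak_shallow_minor_of_ltw1 (G T : graph) (B : T -> {set G})
    (lam : G -> nat) :
  tree_decomposition B -> layering lam ->
  (forall x i, #|B x :&: layer lam i| <= 1) ->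
  weak_shallow_minor 1 G (cartesian (cone T) (path_graph (\max_v lam v))).
Proof.
move=> [_ cover edge conn] lamP thin; set m := \max_v _.
have lam_lt v : lam v < m.+1 by rewrite ltnS; apply: leq_bigmax.
have thin_eq x v w : v \in B x -> w \in B x -> lam v = lam w -> v = w.
  move=> vx wx vw; apply/eqP; have /card_le1_eqP := thin x (lam v).
  by move=> h; apply/eqP/h; rewrite !inE ?vx ?wx ?vw eqxx.
pose K := cartesian (cone T) (path_graph m).
pose g (v : G) (x : T) : K := (Some x, inord (lam v) : path_graph m).
pose mu v : {set K} := g v @: [set x | v \in B x].
exists mu; split; first split.
- move=> v; have [x vx] := cover v; split.
    by apply/set0Pn; exists (g v x); apply: imset_f; rewrite inE.
  apply: connected_imset (conn v) _ => x' y' _ _ xy.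
  by rewrite /= /cartesian_adj /= xy eqxx.
- move=> v w; apply: contraR => /pred0Pn[_ /andP[/imsetP[x vx ->]]].
  case/imsetP=> y; rewrite !inE in vx * => wy [xy /(congr1 val)].
  rewrite /= !inordK // => vw; rewrite -xy in wy.
  by rewrite (thin_eq x v w).
- move=> v w vw; have [x /andP[vx wx]] := edge v w vw.
  exists (g v x), (g w x); split; try by rewrite imset_f // inE.
  rewrite /= /cartesian_adj /= eqxx /= adj_irr /path_adj !inordK //.
  have := lamP v w vw; have ne : lam v <> lam w.
    by move=> /(thin_eq _ _ _ vx wx) e; rewrite e adj_irr in vw.
  lia.
- move=> v; pose c : K := (None, inord (lam v) : path_graph m).
  apply: is_min_nat_exists; exists c => _ /imsetP[x _ ->].
  exists 1; split=> //; split.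
    by exists [:: g v x]; rewrite /= /cartesian_adj /= eqxx.
  by move=> [|d] // [[|b p] [_ /= cE sz]].
Qed.

(** * A grid forces large bags *)

(** Column [t] together with the double row [j]: the first argument of [g] is
    the column, and rows are taken in pairs because a single row of the grid
    below has no edges. *)
Definition cross (V : finType) k (g : nat -> nat -> V) (j t : nat) : {set V} :=
  [set g p.1 p.2 | p : 'I_k * 'I_k.*2 & (p.1 == t :> nat) || (p.2./2 == j)].

Lemma crossP (V : finType) k (g : nat -> nat -> V) j t v :
  reflect (exists t' i, [/\ t' < k, i < k.*2, (t' == t) || (i./2 == j) & v = g t' i])
          (v \in cross k g j t).
Proof.
apply: (iffP imsetP) => [[[t' i]]|[t' [i [tk ik tj ->]]]].
  by rewrite inE /= => tj ->; exists t', i; rewrite !ltn_ord.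
by exists (Ordinal tk, Ordinal ik); rewrite ?inE.
Qed.

(** The zigzag [(t+1, 2j), (t, 2j+1), (t, 2j)] leads from each column to the
    previous one within the double row [j]. *)
Lemma cross_connected (H : graph) k (g : nat -> nat -> H) j t :
  (forall t i, t < k -> i.+1 < k.*2 -> adj (g t i) (g t i.+1)) ->
  (forall t i, t.+1 < k -> i.+1 < k.*2 -> adj (g t.+1 i) (g t i.+1)) ->
  j < k -> t < k -> connected (induced (cross k g j t)).
Proof.
move=> vert diag jk tk; set U := cross k g j t.
have step t1 i1 t2 i2 : t1 < k -> i1 < k.*2 -> t2 < k -> i2 < k.*2 ->
    (t1 == t) || (i1./2 == j) -> (t2 == t) || (i2./2 == j) ->
    adj (g t1 i1) (g t2 i2) -> connect (within U) (g t1 i1) (g t2 i2).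
  move=> ? ? ? ? ? ? a12; apply: connect1; apply/and3P; split=> //; apply/crossP.
    by exists t1, i1.
  by exists t2, i2.
have col i : i < k.*2 -> connect (within U) (g t i) (g t 0).
  elim: i => // i IHi ik; apply: connect_trans (IHi (ltnW ik)).
  by apply: step; rewrite ?eqxx // 1?ltnW // adj_sym vert.
have up t' : t' < k -> connect (within U) (g t' j.*2.+1) (g t' j.*2).
  by move=> t'k; apply: step; rewrite ?eqxx ?orbT //; last rewrite adj_sym vert; lia.
have row t' : t' < k -> connect (within U) (g t' j.*2) (g 0 j.*2).
  elim: t' => // t' IHt t'k; have t'k' := ltnW t'k.
  apply: connect_trans (IHt t'k'); apply: connect_trans (up _ t'k').
  by apply: step; rewrite ?diag //; lia.
apply: (@connected_of_root _ _ (g t j.*2)) => _ /crossP[t' [i [t'k ik ti ->]]].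
have jk2 : j.*2 < k.*2 by lia.
case/orP: ti => [/eqP-> | /eqP ij].
  by apply: connect_trans (col i ik) _; rewrite connect_withinC col.
apply: (@connect_trans _ _ (g t' j.*2)).
  have [->|->] : i = j.*2 \/ i = j.*2.+1 by lia.
    exact: connect0.
  exact: up.
by apply: connect_trans (row t' t'k) _; rewrite connect_withinC row.
Qed.

Lemma leq_card_of_transversal (V I : finType) (A : {set V}) (P : I -> V -> Prop) :
  (forall i, exists2 v, v \in A & P i v) ->
  (forall i j v, P i v -> P j v -> i = j) -> #|I| <= #|A|.
Proof.
move=> exP Pinj; have [f fA fP] := fin_all_exists2 exP.
have f_inj : injective f by move=> i j fij; apply: (Pinj i j (f i)); rewrite // fij.
rewrite -(card_imset _ f_inj) subset_leq_card //.
by apply/subsetP => _ /imsetP[i _ ->].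
Qed.

(** Any two crosses meet, so some bag meets all of them. A set that meets all
    crosses meets every double row, or misses one of them and then meets every
    column; either way it has at least [k] elements. *)
Lemma grid_large_bag (H T : graph) (B : T -> {set H}) k (g : nat -> nat -> H) :
  (forall t t' i i', t < k -> t' < k -> i < k.*2 -> i' < k.*2 ->
     g t i = g t' i' -> t = t' /\ i = i') ->
  (forall t i, t < k -> i.+1 < k.*2 -> adj (g t i) (g t i.+1)) ->
  (forall t i, t.+1 < k -> i.+1 < k.*2 -> adj (g t.+1 i) (g t i.+1)) ->
  tree_decomposition B -> exists x, k <= #|B x|.
Proof.
move=> g_inj vert diag tB.
have [||x xP] := @bag_meets_all _ _ B ('I_k * 'I_k)%type
  (fun jt => cross k g jt.1 jt.2) tB.
- by move=> [j t]; apply: cross_connected => /=.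
- move=> [j t] [j' t']; apply/set0Pn; exists (g t' j.*2).
  by rewrite inE; apply/andP; split; apply/crossP; exists t', j.*2;
    split=> //=; have := ltn_ord j; lia.
exists x; rewrite -[X in X <= _]card_ord.
pose hit_row (j : 'I_k) v :=
  exists t i, [/\ t < k, i < k.*2, i./2 = j & v = g t i].
pose hit_col (t : 'I_k) v := exists2 i, i < k.*2 & v = g t i.
case: (classic (forall j, exists2 v, v \in B x & hit_row j v)) => [rows | miss].
  apply: leq_card_of_transversal rows _ => j j' v [t [i [? ? ij ->]]].
  move=> [t' [i' [? ? ij' /g_inj[] // _ ii']]]; apply: val_inj.
  by rewrite /= -ij -ij' ii'.
have [j jmiss] := not_all_ex_not _ _ miss.
apply: (@leq_card_of_transversal _ _ _ hit_col) => [t | t t' v]; last first.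
  by move=> [i ik ->] [i' i'k /g_inj[] // tt' _]; apply: val_inj.
have /set0Pn[v /setIP[vx]] := xP (j, t).
case/crossP=> t' [i [t'k ik /= ti vE]]; exists v => //.
case/orP: ti => /eqP ti; first by exists i; rewrite -?ti.
by case: jmiss; exists v => //; exists t', i.
Qed.

(** * The prefix graph *)

Lemma eq_in_window l c x y :
  x <= c < x + l -> y <= c < y + l -> x %% l = y %% l -> x = y.
Proof.
wlog xy : x y / x <= y => [hw | xc yc /eqP].
  by case/orP: (leq_total x y) => h xc yc e; [|symmetry]; apply: hw.
rewrite eq_sym eqn_mod_dvd // => /dvdnP[[|q]]; first by lia.
by rewrite mulSn; lia.
Qed.

Section Words.

Variables (a L l : nat).

Definition word : finType := L.-bseq 'I_a.+1.

Implicit Types (u v w : word).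

(** Sequences longer than [L] are sent to the empty word. *)
Definition word_of (s : seq 'I_a.+1) : word := insub_bseq L s.

Lemma word_ofK s : size s <= L -> word_of s = s :> seq _.
Proof. by move=> sL; rewrite /word_of /insub_bseq insubdK. Qed.

Definition parent w : word := word_of (take (size w).-1 w).

Lemma parentE w : parent w = take (size w).-1 w :> seq _.
Proof.
by rewrite word_ofK // size_take_min; have := size_bseq w; lia.
Qed.

Lemma size_parent w : size (parent w) = (size w).-1.
Proof. by rewrite parentE size_take_min; lia. Qed.

(** The empty word is its own [parent], hence the conditions on the sizes. *)
Definition word_tree_adj u v : bool :=
  ((v == parent u) && (0 < size u)) || ((u == parent v) && (0 < size v)).

Fact word_tree_adj_sym : symmetric word_tree_adj.
Proof. by move=> u v; rewrite /word_tree_adj orbC. Qed.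

Fact word_tree_adj_irr : irreflexive word_tree_adj.
Proof.
move=> u; rewrite /word_tree_adj orbb; apply/negbTE/negP=> /andP[/eqP uE u0].
by have := size_parent u; rewrite -uE; lia.
Qed.

Definition word_tree : graph := Graph word_tree_adj_sym word_tree_adj_irr.

Lemma word_tree_tree : tree word_tree.
Proof.
split; first by apply/card_gt0P; exists (word_of [::]).
  apply/connectedT.
  apply: (@connected_of_descent word_tree _ (word_of [::])
    (fun w => size (w : word))).
  move=> w _ w0; have {}w0 : 0 < size (w : word).
    rewrite lt0n; apply: contra w0 => w0; apply/eqP/val_inj => /=.
    by rewrite word_ofK //; apply: size0nil; apply/eqP.
  exists (parent w); rewrite inE size_parent; split=> //; last by lia.
  by rewrite /= /word_tree_adj eqxx w0.
apply: (@forest_of_parent word_tree (fun w => size (w : word)) parent) => u v.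
by case/orP=> /andP[/eqP-> s0]; [right|left]; rewrite size_parent; split=> //; lia.
Qed.

(** The bag of the node [w] in the tree of all words. The lengths of
    the prefixes kept lie in an interval of [l] integers, so they are
    determined by their residues modulo [l]. *)
Definition recent_prefixes w : {set word} :=
  [set u : word | prefix u w && (size w < size u + l)].

(** The layer of a word; consecutive lengths [l - 1] and [l] lie in the two
    extreme layers, not in consecutive ones (for [l > 2]). *)
Definition level u := size u %% l.

(** All pairs that share a bag and lie in consecutive layers: this is the
    richest graph for which the word tree with these bags and these layers
    witnesses layered treewidth one. *)
Definition prefix_graph_adj u v : bool :=
  ((u \in recent_prefixes v) || (v \in recent_prefixes u)) &&
  (`|level u - level v|%N == 1).

Fact prefix_graph_adj_sym : symmetric prefix_graph_adj.
Proof. by move=> u v; rewrite /prefix_graph_adj orbC distnC. Qed.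

Fact prefix_graph_adj_irr : irreflexive prefix_graph_adj.
Proof. by move=> u; rewrite /prefix_graph_adj distnn andbF. Qed.

Definition prefix_graph : graph :=
  Graph prefix_graph_adj_sym prefix_graph_adj_irr.

Lemma prefix_graph_layering : layering (level : prefix_graph -> nat).
Proof. by move=> u v /andP[_ /eqP->]. Qed.

Lemma recent_prefixes_decomposition : 0 < l ->
  @tree_decomposition prefix_graph word_tree recent_prefixes.
Proof.
move=> l0; have self u : u \in recent_prefixes u.
  by rewrite inE prefix_refl; lia.
split; first exact: word_tree_tree.
- by move=> u; exists u.
- move=> u v /andP[/orP[uv|vu] _]; first by exists v; rewrite uv self.
  by exists u; rewrite vu self.
move=> u; apply: (@connected_of_descent word_tree _ u (fun w => size (w : word))).
move=> w; rewrite !inE => /andP[uw wl] wu.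
have su : size u < size w.
  rewrite ltnNge; apply: contra wu => wu; apply/eqP/val_inj => /=.
  by move: uw; rewrite prefixE => /eqP <-; rewrite take_oversize.
have su' : size u <= (size w).-1 by lia.
exists (parent w); split; last by rewrite size_parent; lia.
  rewrite !inE size_parent parentE; move: uw; rewrite !prefixE (take_takel _ su').
  by move=> ->; lia.
by rewrite /= /word_tree_adj eqxx (leq_ltn_trans _ su).
Qed.

Lemma recent_prefixes_thin w i :
  #|recent_prefixes w :&: layer (level : prefix_graph -> nat) i| <= 1.
Proof.
apply/card_le1_eqP => u v; rewrite !inE.
move=> /andP[/andP[uw ul] /eqP ui] /andP[/andP[vw vl] /eqP vi].
have suv : size u = size v.
  by apply: (@eq_in_window l (size w)); rewrite ?size_prefix //; move: ui; rewrite -vi.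
apply: val_inj => /=.
by move: uw vw; rewrite !prefixE suv => /eqP <- /eqP.
Qed.

Lemma prefix_graph_ltw1 : 0 < l -> is_layered_treewidth prefix_graph 1.
Proof.
move=> l0.
have lower (T : graph) (B : T -> {set prefix_graph}) k (lam : prefix_graph -> nat) :
    tree_decomposition B -> (forall x i, #|B x :&: layer lam i| <= k) -> 0 < k.
  move=> [_ cover _ _] thin; have [x rx] := cover (word_of [::]).
  apply: leq_trans (thin x (lam (word_of [::]))).
  by apply/card_gt0P; exists (word_of [::]); rewrite !inE rx eqxx.
split.
  exists word_tree, recent_prefixes; split.
    exact: recent_prefixes_decomposition.
  split.
    by exists level; split; [exact: prefix_graph_layering | exact: recent_prefixes_thin].
  move=> k [lam [_ thin]]; rewrite leEnat.
  exact: lower (recent_prefixes_decomposition l0) thin.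
move=> k [T [B [tB [[lam [_ thin]] _]]]]; rewrite leEnat.
exact: lower tB thin.
Qed.

Lemma take_adj (s : seq 'I_a.+1) d e :
  size s <= L -> d <= e <= size s -> e < d + l -> `|d %% l - e %% l|%N = 1 ->
  @adj prefix_graph (word_of (take d s)) (word_of (take e s)).
Proof.
move=> sL /andP[de es] edl lev.
have dE : size (take d s) = d by rewrite size_takel //; lia.
have eE : size (take e s) = e by rewrite size_takel.
rewrite /= /prefix_graph_adj /level inE !word_ofK ?dE ?eE //; try lia.
by rewrite lev eqxx prefixE dE take_takel // eqxx edl.
Qed.

End Words.

(** * Row treewidth of the prefix graph *)

Lemma strong_adj_fst (H K : graph) (x y : strong H K) :
  adj x y -> x.1 != y.1 -> adj x.1 y.1.
Proof.
by case/or3P=> /andP[] // /eqP -> _; rewrite eqxx.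
Qed.

Lemma strong_path_adj_snd (H : graph) m (x y : strong H (path_graph m)) :
  adj x y -> x.2 <= y.2.+1 /\ y.2 <= x.2.+1.
Proof.
case/or3P=> /andP[_]; first by move/eqP=> ->; lia.
  by case/orP=> /eqP <-; lia.
by case/orP=> /eqP <-; lia.
Qed.

(** Children of a common word need a common neighbour. The parent is one,
    except when the children start a new period, in layer [0]; then it is the
    ancestor in layer [1] of the period just completed. *)
Lemma earlier_index l e : 1 < l ->
  exists d, [/\ d <= e, e.+1 < d + l & `|d %% l - e.+1 %% l|%N = 1].
Proof.
move=> l1; have := divn_eq e.+1 l; have := @ltn_pmod e.+1 l (ltnW l1).
case r: (e.+1 %% l) => [|i] il eE.
  case: (e.+1 %/ l) eE => // q; rewrite mulSn => eE.
  exists (q * l + 1); split; try lia.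
  by rewrite modnMDl modn_small.
exists e; split; try lia.
have -> : e = (e.+1 %/ l) * l + i by lia.
by rewrite modnMDl modn_small ?distSn; lia.
Qed.

(** The word is built letter by letter. The children of the current word have
    a common neighbour, so they occupy at most three layers of the path, and
    each part [{h} x P] contains at most three of them. There are
    more children than can be absorbed by the parts of the prefixes already
    built, so some child lies in a new part. *)
Lemma branch_with_distinct_parts (H : graph) m a L l
    (f : prefix_graph a L l -> strong H (path_graph m)) :
  1 < l -> 3 * L.+1 <= a ->
  injective f -> {homo f : u v / adj u v} ->
  exists2 s : seq 'I_a.+1, size s = L &
    forall d e, d < e <= L ->
      (f (word_of L (take d s))).1 != (f (word_of L (take e s))).1.
Proof.
move=> l1 aL f_inj f_adj.
suff: forall n, n <= L -> exists2 s : seq 'I_a.+1, size s = n &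
    forall d e, d < e <= n ->
      (f (word_of L (take d s))).1 != (f (word_of L (take e s))).1.
  by move=> /(_ L (leqnn L)).
elim=> [|n IHn] nL.
  by exists [::] => // d e; lia.
have [s sn sP] := IHn (ltnW nL).
pose part c := f (word_of L (rcons s c)).
have [c cP]: exists c, forall d, d <= n -> (f (word_of L (take d s))).1 != (part c).1.
  apply: NNPP => bad.
  have clash c : exists d : 'I_L.+1, (f (word_of L (take d s))).1 = (part c).1.
    apply: NNPP => good; case: bad; exists c => d dn; apply/eqP => dc.
    by case: good; exists (Ordinal (leq_ltn_trans dn (ltnW nL : n < L.+1))).
  have [D DP] := fin_all_exists clash.
  have [d [dn ndl lev]] := earlier_index n l1.
  pose y : nat := (f (word_of L (take d s))).2.
  pose lv c : nat := (part c).2.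
  have near c : lv c <= y.+1 /\ y <= (lv c).+1.
    apply: (@strong_path_adj_snd H m); rewrite adj_sym; apply: f_adj.
    have -> : take d s = take d (rcons s c) by rewrite -cats1 takel_cat // sn.
    have -> : rcons s c = take n.+1 (rcons s c).
      by rewrite take_oversize // size_rcons sn.
    have -> : take d (take n.+1 (rcons s c)) = take d (rcons s c).
      by rewrite take_takel //; lia.
    by apply: take_adj => //; rewrite size_rcons sn //; lia.
  (* If every child fell into an old part, it would be determined by the
     prefix whose part it shares and by its layer relative to [y]. *)
  pose code c : 'I_L.+1 * 'I_3 := (D c, inord ((lv c).+1 - y)).
  have code_inj : injective code.
    move=> c c' [DE /(congr1 val)]; have [? ?] := near c; have [? ?] := near c'.
    rewrite /= !inordK; try lia.
    move=> e; have lvE : lv c = lv c' by lia.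
    have: part c = part c'.
      rewrite [part c]surjective_pairing [part c']surjective_pairing.
      rewrite -!DP DE; congr (_, _); exact: val_inj lvE.
    move/f_inj/(congr1 val); rewrite /= !word_ofK ?size_rcons ?sn //.
    by move/rcons_inj => [].
  have := leq_card code code_inj; rewrite card_prod !card_ord; lia.
exists (rcons s c); first by rewrite size_rcons sn.
have take_s d : d <= n -> take d (rcons s c) = take d s.
  by move=> dn; rewrite -cats1 takel_cat // sn.
move=> d e; rewrite [e <= _]leq_eqVlt ltnS => /andP[de /orP[/eqP eE | en]].
  rewrite take_s; last by lia.
  by rewrite [take e _]take_oversize ?size_rcons ?sn ?eE // cP //; lia.
by rewrite !take_s //; [apply: sP; rewrite de | lia].
Qed.

(** Along the word provided by [branch_with_distinct_parts], passing to parts is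
    injective on prefixes, so edges between prefixes become edges of [H]. The
    prefix of length [t * 2k + i] serves as the grid vertex in column [t] and
    row [i]: lengths [d] and [d + 1], as well as [d] and [d + 2k - 1], differ
    by less than [2k] and, away from the ends of a period, lie in
    consecutive layers. *)
Lemma prefix_graph_large_bag (H T : graph) (B : T -> {set H}) m k a :
  0 < k -> 3 * (k * k.*2).+1 <= a ->
  isomorphic_to_subgraph (prefix_graph a (k * k.*2) k.*2) (strong H (path_graph m)) ->
  tree_decomposition B -> exists x, k <= #|B x|.
Proof.
move=> k0; set L := k * k.*2 => aL [f [f_inj f_adj]] tB.
have l1 : 1 < k.*2 by lia.
have [s sL sP] := branch_with_distinct_parts l1 aL f_inj f_adj.
pose h d := (f (word_of L (take d s))).1.
have hP d e : d < e <= L -> h d != h e by exact: sP.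
have h_inj d e : d <= L -> e <= L -> h d = h e -> d = e.
  move=> dL eL hde; case: (ltngtP d e) => // lt.
    by have := hP d e; rewrite lt eL hde eqxx => /(_ isT).
  by have := hP e d; rewrite lt dL hde eqxx => /(_ isT).
have h_adj d e : d < e <= L -> e < d + k.*2 -> `|d %% k.*2 - e %% k.*2|%N = 1 ->
    adj (h d) (h e).
  move=> /andP[de eL] edl lev; apply: strong_adj_fst; last by apply: hP; rewrite de.
  by apply/f_adj/take_adj; rewrite ?sL //; lia.
have idx t i : t < k -> i < k.*2 -> t * k.*2 + i < L.
  move=> tk ik; have : t.+1 * k.*2 <= L by rewrite leq_mul2r tk orbT.
  by rewrite mulSn; lia.
apply: (@grid_large_bag H T B k (fun t i => h (t * k.*2 + i))) tB.
- move=> t t' i i' tk t'k ik i'k /h_inj e.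
  have {}e := e (ltnW (idx _ _ tk ik)) (ltnW (idx _ _ t'k i'k)).
  have := congr1 (modn^~ k.*2) e; have := congr1 (divn^~ k.*2) e.
  by rewrite !modnMDl !divnMDl ?modn_small ?divn_small ?addn0 //; lia.
- move=> t i tk ik; have := idx _ _ tk ik; have ik' := ltnW ik.
  move=> ?; apply: h_adj; try lia.
  by rewrite !modnMDl !modn_small //; lia.
- move=> t i tk ik; have := idx _ _ tk (ltnW ik); have ik' := ltnW ik.
  move=> ?; rewrite adj_sym; apply: h_adj; rewrite ?mulSn; try lia.
  by rewrite -mulSn !modnMDl !modn_small //; lia.
Qed.

Lemma width_ge (H T : graph) (B : T -> {set H}) x : (#|B x|%:Z - 1 <= width B)%R.
Proof.
have : #|B x| <= \max_(y : T) #|B y| by apply: leq_bigmax.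
rewrite /width; lia.
Qed.

Lemma treewidth_exists (H : graph) : exists w, is_treewidth H w.
Proof.
pose T : graph := @Graph unit (fun _ _ => false) (fun _ _ => erefl) (fun _ => erefl).
apply: (@is_min_int_exists _ (-1) (width (fun _ : T => [set: H]))).
  by move=> _ [T' [B [_ ->]]]; rewrite /width; lia.
exists T, (fun _ => [set: H]); split=> //; split.
- split; first by rewrite card_unit.
    by move=> [] [].
  by move=> [|[] [|[] c]] //.
- by move=> v; exists tt; rewrite inE.
- by move=> v w _; exists tt; rewrite !inE.
- move=> v x y; have -> : x = y by apply: val_inj; case: (val x); case: (val y).
  exact: connect0.
Qed.

Lemma row_treewidth_exists_ge (G : graph) (b : int) :
  (forall (H T : graph) (B : T -> {set H}) m, tree_decomposition B ->
     isomorphic_to_subgraph G (strong H (path_graph m)) -> (b <= width B)%R) ->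
  exists w, is_row_treewidth G w /\ (b <= w)%R.
Proof.
move=> lower; have lower' v : (exists (H : graph) m, is_treewidth H v /\
    isomorphic_to_subgraph G (strong H (path_graph m))) -> (b <= v)%R.
  by move=> [H [m [[[T [B [tB ->]]] _] GH]]]; apply: lower tB GH.
have [w0 w0P] := treewidth_exists G.
have [|w wP] := is_min_int_exists lower' (w := w0).
  exists G, 0; split=> //; exists (fun x => (x, ord0 : path_graph 0)).
  by split=> [x y [] | x y xy] //; rewrite /= /strong_adj /= xy eqxx.
by exists w; split=> //; apply: lower'; case: wP.
Qed.

Theorem corollary6p5 (n : int) :
  exists G : graph,
    [/\ is_layered_treewidth G 1,
        exists w : int, is_row_treewidth G w /\ (n <= w)%R
      & exists (J : graph) (m : nat),
          apex_forest J /\ weak_shallow_minor 1 G (cartesian J (path_graph m))].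
Proof.
pose k := `|n|%N.+1; pose L := k * k.*2; pose a := 3 * L.+1.
exists (prefix_graph a L k.*2); split.
- exact: prefix_graph_ltw1.
- apply: row_treewidth_exists_ge => H T B m tB GH.
  have [x kx] := prefix_graph_large_bag (isT : 0 < k) (leqnn a) GH tB.
  by have := width_ge B x; lia.
have [_ _ fT] := word_tree_tree a L.
eexists (cone (word_tree a L)), _; split; first exact: apex_forest_cone.
apply: (weak_shallow_minor_of_ltw1 (recent_prefixes_decomposition a L _)
  (@prefix_graph_layering a L k.*2) (@recent_prefixes_thin a L k.*2)).
by [].
Qed.
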